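(* Consider the distributed algorithm \textsc{Evacuation} described in the context, applied to an instance $(G,X,H)$ of the evacuation problem. If $d_j$ is the number of colors used for the zone graph computed in the $j$-th epoch (i.e., the iteration of the main loop with $B=2^j$), then all agents evacuate within $s$ steps, where \[ s=6\sum_{j=1}^{p} d_j 2^j \quad\text{and}\quad p=\lceil \log_2 OPT\rceil .\]
   Context: Evacuation model: a finite simple undirected graph $G=(V,E)$ with unique vertex identifiers, a nonempty set $X\subseteq V$ of exits and a set $H\subseteq V\setminus X$ of homebases, one agent (with unique id) initially at each homebase. Agents know $G$ and $X$ but not $H$ or $|H|$. Time proceeds in synchronous steps; in each step agents at vertices at distance at most 2 may exchange any finite number of messages (and messages may be relayed), then each agent moves to a neighboring vertex or stays; moves are simultaneous, no two agents may occupy the same vertex after the moves (swaps allowed), and an agent at an exit at the end of a step is removed (evacuates). An evacuation strategy assigns to each agent $i$ positions $\mathrm{loc}_i(s)$ at the end of each step $s$ (consecutive positions equal or adjacent, $\mathrm{loc}_i(0)$ the homebase), such that each agent $i$ reaches an exit at some step $s_i$ and no two agents share a vertex at any step $s\le\min\{s_i,s_j\}$; its length is $\max_i s_i$; it is successful if all agents for which it is defined evacuate. $OPT$ is the minimum length of an evacuation strategy for the instance. $\mathrm{dist}(u,v)$ is the length of a shortest $uv$-path in $G$ containing no exit. $B$-partition: for an integer $B\ge0$, $(V_1,\dots,V_l)$ is a $B$-partition of $G$ if the $V_i$ are pairwise disjoint with union $V$, and for each $i$ there is a spanning tree of $G[V_i\setminus X]$ with a root $v_i\in V_i$ such that every $v\in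 V_i$ is at distance at most $B$ from $v_i$ along the tree. Each $V_i$ is a zone. For a zone $Z$, $\mathcal{A}(Z)$ is the set of agents whose homebase lies in $Z$. Zones $Z,Z'$ are close if there are $z\in Z$, $z'\in Z'$ with $\mathrm{dist}(z,z')\le 2B$. An evacuation strategy is internal for $\mathcal{A}(Z)$ if all agents of $\mathcal{A}(Z)$ stay on vertices of $Z$ during its execution. $Z$ is self-sufficient (w.r.t. $B$) if there exists an internal evacuation strategy for $\mathcal{A}(Z)$ that can be computed by the agents and completed in $B$ steps. An exclusive strategy for $\mathcal{A}(Z)$ is an evacuation strategy for the instance on the whole graph $G$ with all exits $X$, in which only the agents of $\mathcal{A}(Z)$ are present. A set of agents $A$ forms a group if the subgraph induced by $\bigcup_{a\in A}N[a]$ is connected, where $N[a]$ is the closed neighborhood of the vertex occupied by $a$. The zone graph $\mathcal{G}$ has the zones as vertices, with $Z,Z'$ adjacent iff they are close and neither is self-sufficient. A $d$-coloring of $\mathcal{G}$ is a map $c$ from zones to $\{1,\dots,d\}$ with $c(Z)\ne c(Z')$ for adjacent $Z,Z'$. Algorithm \textsc{SinglePhase}$(B,\mathcal{Z})$, for a set $\mathcal{Z}$ of zones, starting at step $t$: for each $Z\in\mathcal{Z}$, if $Z$ is self-sufficient, the agents of $\mathcal{A}(Z)$ compute an internal strategy and execute it in steps $t,\dots,t+B-1$; otherwise, the agents of $\mathcal{A}(Z)$ are grouped in steps $t,\dots,t+B-1$, then compute an exclusive strategy for $\mathcal{A}(Z)$ taking their current positions as homebases, and execute it in steps $t+B,\dots,t+3B-1$.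 (This $3B$-step block is a phase.) Algorithm \textsc{OneAttempt}$(B,(V_1,\dots,V_l))$: compute the zone graph $\mathcal{G}$ and a $d$-coloring $c$ of it (the same for all agents); for each $i=1,\dots,d$: call \textsc{SinglePhase}$(B,c^{-1}(i))$, then backtrack the movements of all (non-evacuated) agents initially in zones of color $i$ to their homebases. Algorithm \textsc{Evacuation}: set $B=2$; while there are agents present in the graph: compute a $B$-partition $(V_1,\dots,V_l)$, call \textsc{OneAttempt}$(B,(V_1,\dots,V_l))$, and set $B=2B$.
   Formalization: The formal statement uses p = max(1, ⌈log₂ OPT⌉): for OPT = 1 the stated formula gives p = 0 and s = 0, which is false since no homebase is an exit; for OPT ≥ 2 the formula is unchanged. *)

(* Defs.v *)
From mathcomp Require Import all_boot.

Set Implicit Arguments.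
Unset Strict Implicit.
Unset Printing Implicit Defensive.

(* Conventions (plain Mathematical Components).
   - The graph is a symmetric irreflexive relation e on a finite type V.
   - X is the set of exits, H the set of homebases.  There is one agent per
     homebase and the agent's unique id is the identifier of its homebase, so
     agents are named by elements of V and "the agents" are the elements of H.
   - loc a s is the position of agent a at the end of step s, and loc a 0 its
     initial position.  An agent is removed the first time it is on an exit;
     the later values of loc are meaningless and are never constrained.
   - A block "executed in steps t, ..., t+n-1" leads from time t to time t+n,
     where time s is the moment at which s steps have been completed. *)

Section Evacuation.

Variables (V : finType) (e : rel V) (X : {set V}).

Implicit Types (A H Z : {set V}) (P : {set {set V}}) (loc sg : V -> nat -> V).

Definition stay_or_move : rel V := [rel u v | (u == v) || e u v].

Definition evacuated_by loc (s : nat) (a : V) : bool :=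
  [exists r : 'I_s.+1, loc a r \in X].

Definition present loc (s : nat) (a : V) : bool := ~~ evacuated_by loc s a.

(** Evacuation strategies *)

(* T a is the step at which a reaches its exit.  All exits of the graph may be
   used, and only the agents of A are present. *)
Definition evacuation_strategy A (start : V -> V) sg (T : V -> nat) : Prop :=
  [/\ forall a, a \in A -> sg a 0 = start a,
      forall a s, a \in A -> s < T a -> stay_or_move (sg a s) (sg a s.+1),
      forall a, a \in A ->
        sg a (T a) \in X /\ (forall s, s < T a -> sg a s \notin X)
    & forall a b s, a \in A -> b \in A -> a != b -> s <= minn (T a) (T b) ->
        sg a s != sg b s].

Definition strategy_length A (T : V -> nat) : nat := \max_(a in A) T a.

Definition internal A Z sg (T : V -> nat) : Prop :=
  forall a s, a \in A -> s <= T a -> sg a s \in Z.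

Definition is_OPT H (opt : nat) : Prop :=
  (exists sg T, evacuation_strategy H id sg T /\ strategy_length H T = opt) /\
  (forall sg T, evacuation_strategy H id sg T -> opt <= strategy_length H T).

(** B-partitions *)

Definition spanning_tree (U : {set V}) (t : rel V) : Prop :=
  [/\ symmetric t,
      forall u v, t u v -> [/\ u \in U, v \in U & e u v],
      {in U &, forall u v, connect t u v}
    & forall c, ucycle t c -> size c <= 2].

Definition tree_dist_le (t : rel V) (k : nat) (u v : V) : Prop :=
  exists p, [/\ path t u p, last u p = v & size p <= k].

(* The exits of a zone are not vertices of its tree, so the root is a non-exit
   and the depth bound concerns the non-exit vertices of the zone. *)
Definition B_partition (B : nat) P : Prop :=
  partition P [set: V] /\
  forall Z, Z \in P -> exists t root,
    [/\ spanning_tree (Z :\: X) t,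
        root \in Z :\: X
      & forall v, v \in Z :\: X -> tree_dist_le t B root v].

(* dist u v <= k, where dist only takes exit-free paths into account. *)
Definition dist_le (k : nat) (u v : V) : Prop :=
  exists p, [/\ path e u p, last u p = v,
                all (fun w => w \notin X) (u :: p) & size p <= k].

Definition close (B : nat) Z Z' : Prop :=
  exists z z', [/\ z \in Z, z' \in Z' & dist_le (2 * B) z z'].

(** Local communication *)

Definition within2 : rel V :=
  [rel u v | [|| u == v, e u v | [exists w, e u w && e w v]]].

(* The agents of A that can exchange messages at time s, without relaying. *)
Definition talk A loc (s : nat) : rel V :=
  [rel a b | [&& a \in A, b \in A, present loc s a, present loc s b &
                 within2 (loc a s) (loc b s)]].

(* After the communication round at time s, agent a has learnt where agent b
   was at time r.  Messages are relayed along connected components of talk,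
   and agents pass on everything they know. *)
Fixpoint knows A loc (s : nat) (a b : V) (r : nat) : bool :=
  if s is s'.+1 then
    if r == s then connect (talk A loc s) a b
    else [exists c, connect (talk A loc s) a c && knows A loc s' c b r]
  else (r == 0) && connect (talk A loc 0) a b.

Definition view A loc (s : nat) (a : V) : V -> nat -> option V :=
  fun b r => if knows A loc s a b r then Some (loc b r) else None.

(* A deterministic distributed algorithm: the next position of an agent, given
   its id, the current time and what it has learnt so far.  As views contain
   everything that can be learnt, there is no loss in letting messages be
   implicit. *)
Definition protocol := V -> nat -> (V -> nat -> option V) -> V.

Definition follows (F : protocol) A loc : Prop :=
  forall a s, a \in A -> present loc s a ->
    loc a s.+1 = F a s (view A loc s a).

(* The agents know G and X but not the homebases.  The same protocol must hence
   work for every possible set of homebases, which makes self-sufficiency a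
   property of G, X, B and Z that all agents can evaluate. *)
Definition self_sufficient (B : nat) Z : Prop :=
  exists F : protocol, forall H, H \subset ~: X ->
    let A := H :&: Z in
    exists sg T, [/\ follows F A sg,
                     evacuation_strategy A id sg T,
                     internal A Z sg T
                   & strategy_length A T <= B].

(** Zone graph *)

Definition zone_adj (B : nat) Z Z' : Prop :=
  [/\ Z != Z', close B Z Z', ~ self_sufficient B Z & ~ self_sufficient B Z'].

Definition zone_coloring (B : nat) P (d : nat) (c : {set V} -> 'I_d) : Prop :=
  forall Z Z', Z \in P -> Z' \in P -> zone_adj B Z Z' -> c Z != c Z'.

(** The algorithm *)

Definition closed_nbh (u : V) : {set V} := [set v | (v == u) || e u v].

(* Q is the set of vertices occupied by the agents. *)
Definition forms_group (Q : {set V}) : Prop :=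
  let U := \bigcup_(q in Q) closed_nbh q in
  {in U &, forall u v,
     connect [rel x y | [&& x \in U, y \in U & e x y]] u v}.

(* From time t on and for n steps, the agents of A follow the strategy sg
   (each of them until it evacuates). *)
Definition executes loc A (t n : nat) sg (T : V -> nat) : Prop :=
  forall a r, a \in A -> r <= minn n (T a) -> loc a (t + r) = sg a r.

(* The agents of A(Z) that have not evacuated by time t. *)
Definition crew H loc (t : nat) Z : {set V} :=
  [set a in H :&: Z | present loc t a].

(* Grouping of A from time t to time t + B, without collisions inside A. *)
Definition grouping loc A (t B : nat) : Prop :=
  (forall a b r, a \in A -> b \in A -> a != b -> r < B ->
     present loc (t + r) a -> present loc (t + r) b ->
     loc a (t + r).+1 != loc b (t + r).+1) /\
  forms_group [set loc a (t + B) | a in A & present loc (t + B) a].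

(* The part of SinglePhase that concerns the zone Z, started at time t.  An
   exclusive strategy is given 2B steps.  The one that is computed has to fit
   in if this is possible at all (as a shortest one does); otherwise its first
   2B steps are executed. *)
Definition single_phase H loc (B t : nat) Z : Prop :=
  let A := crew H loc t Z in
  (self_sufficient B Z ->
     exists sg T, [/\ evacuation_strategy A (loc^~ t) sg T,
                      internal A Z sg T,
                      strategy_length A T <= B
                    & executes loc A t B sg T]) /\
  (~ self_sufficient B Z ->
     grouping loc A t B /\
     let A' := crew H loc (t + B) Z in
     exists sg T, [/\ evacuation_strategy A' (loc^~ (t + B)) sg T,
                      (exists sg' T',
                         evacuation_strategy A' (loc^~ (t + B)) sg' T' /\
                         strategy_length A' T' <= 2 * B) ->
                      strategy_length A' T <= 2 * B
                    & executes loc A' (t + B) (2 * B) sg T]).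

(* Undo the n steps that precede time t, in n steps. *)
Definition backtrack loc A (t n : nat) : Prop :=
  forall a r, a \in A -> r <= n -> loc a (t + r) = loc a (t - r).

Definition phase_duration (B : nat) : nat := 3 * B.

(* A phase and the subsequent backtracking. *)
Definition round_duration (B : nat) : nat :=
  phase_duration B + phase_duration B.

(* OneAttempt started at time t.  The agents of the zones whose color is not
   being processed do not move.  As exclusive strategies are computed as if the
   agents of one zone were alone, agents of different zones are not required
   to avoid each other: executions without such encounters are a special case. *)
Definition one_attempt H loc (B : nat) P (d : nat) (c : {set V} -> 'I_d)
    (t : nat) : Prop :=
  forall i : 'I_d, let u := t + i * round_duration B in
  [/\ forall Z, Z \in P -> c Z = i -> single_phase H loc B u Z,
      forall Z, Z \in P -> c Z = i ->
        let u' := u + phase_duration B in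
        backtrack loc (crew H loc u' Z) u' (phase_duration B)
    & forall Z a r, Z \in P -> c Z != i -> a \in crew H loc u Z ->
        r <= round_duration B -> loc a (u + r) = loc a u].

(* The number of steps taken by the epochs 1, ..., j, if epoch k uses d k
   colors; epoch k is the iteration of the main loop with B = 2 ^ k. *)
Fixpoint elapsed (d : nat -> nat) (j : nat) : nat :=
  if j is j'.+1 then elapsed d j' + d j * round_duration (2 ^ j) else 0.

(* loc is an execution of the algorithm in which epoch j uses d j colors.  The
   values d j for epochs that do not take place are arbitrary. *)
Definition evacuation_execution H (d : nat -> nat) loc : Prop :=
  [/\ forall a, a \in H -> loc a 0 = a,
      forall a s, a \in H -> present loc s a ->
        stay_or_move (loc a s) (loc a s.+1)
    & forall j, (exists2 a, a \in H & present loc (elapsed d j) a) ->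
        let B := 2 ^ j.+1 in
        exists P (c : {set V} -> 'I_(d j.+1)),
          [/\ B_partition B P, zone_coloring B P c
            & one_attempt H loc B P c (elapsed d j)]].

End Evacuation.

(* Main.v *)
Require Import Defs.
From mathcomp Require Import all_boot.
From mathcomp Require Import zify.

Set Implicit Arguments.
Unset Strict Implicit.
Unset Printing Implicit Defensive.

(* Backtracking brings every remaining agent home after each color, hence at
   the start of every color of every epoch.  In an epoch with OPT <= B, a zone
   that is not self-sufficient has an exclusive strategy of length at most 2B
   after the grouping: undo the B grouping steps, then follow an optimal
   strategy for H, restricted to the agents of the zone.  Hence every color
   evacuates all agents of its zones. *)

Section Evacuation.

Variables (V : finType) (e : rel V) (X : {set V}).

Implicit Types (A H Z : {set V}) (P : {set {set V}}) (loc sg : V -> nat -> V).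

Lemma evacuated_byP loc s a :
  reflect (exists2 r, r <= s & loc a r \in X) (evacuated_by X loc s a).
Proof.
apply: (iffP existsP) => [[r Xr]|[r le_rs Xr]]; first by exists r => //; rewrite -ltnS.
by exists (Ordinal (le_rs : r < s.+1)).
Qed.

Lemma evacuated_by_leq loc s s' a :
  s <= s' -> evacuated_by X loc s a -> evacuated_by X loc s' a.
Proof.
move=> le_ss' /evacuated_byP[r le_rs Xr]; apply/evacuated_byP.
by exists r => //; apply: leq_trans le_ss'.
Qed.

Lemma present_leq loc s s' a :
  s <= s' -> present X loc s' a -> present X loc s a.
Proof. by move=> le_ss'; apply/contra/evacuated_by_leq. Qed.

Lemma present_notin_exits loc s r a :
  present X loc s a -> r <= s -> loc a r \notin X.
Proof.
by move=> pr_a le_rs; apply: contra pr_a => Xr; apply/evacuated_byP; exists r.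
Qed.

Lemma mem_crew H loc t Z a :
  (a \in crew X H loc t Z) = [&& a \in H, a \in Z & present X loc t a].
Proof. by rewrite !inE andbA. Qed.

Lemma crew_leq H loc t t' Z :
  t <= t' -> crew X H loc t' Z \subset crew X H loc t Z.
Proof.
move=> le_tt'; apply/subsetP => a; rewrite !mem_crew => /and3P[-> ->].
exact: present_leq.
Qed.

Lemma leq_strategy_length A (T : V -> nat) a :
  a \in A -> T a <= strategy_length A T.
Proof. by move=> Aa; apply: (leq_bigmax_cond _ Aa). Qed.

Lemma executes_evacuates loc A t n start sg T a :
    evacuation_strategy e X A start sg T -> strategy_length A T <= n ->
    executes loc A t n sg T -> a \in A ->
  evacuated_by X loc (t + n) a.
Proof.
move=> [_ _ exitA _] le_Tn run Aa.
have le_Ta: T a <= n := leq_trans (leq_strategy_length T Aa) le_Tn.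
apply/evacuated_byP; exists (t + T a); first by rewrite leq_add2l.
by rewrite run ?leq_min ?le_Ta //=; case: (exitA a Aa).
Qed.

Lemma evacuation_strategy_sub A A' start start' sg T :
    A' \subset A -> {in A', start =1 start'} ->
    evacuation_strategy e X A start sg T ->
  evacuation_strategy e X A' start' sg T.
Proof.
move=> /subsetP sA'A eq_start [sg0 step exitA disj].
split=> [a A'a|a s /sA'A|a /sA'A|a b s /sA'A Aa /sA'A]; auto.
by rewrite sg0 ?sA'A ?eq_start.
Qed.

(** Serves as the witness that agents displaced by grouping still have a short exclusive
    strategy. *)
Definition rewind loc t n sg : V -> nat -> V :=
  fun a s => if s < n then loc a (t + (n - s)) else sg a (s - n).

(** Reversed moves are legal since [e] is symmetric, and they avoid exits since all agents are still
    present at time [t + n]. The hypothesis on collisions covers times [t + 1] to [t + n]; time [t]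
    is the start of [sg], which has no collisions itself. *)
Lemma rewind_strategy loc A t n sg T :
    symmetric e ->
    (forall a, a \in A -> present X loc (t + n) a) ->
    (forall a s, a \in A -> s < t + n -> stay_or_move e (loc a s) (loc a s.+1)) ->
    (forall a b r, a \in A -> b \in A -> a != b -> r < n ->
       loc a (t + r).+1 != loc b (t + r).+1) ->
    evacuation_strategy e X A (loc^~ t) sg T ->
  evacuation_strategy e X A (loc^~ (t + n)) (rewind loc t n sg)
    (fun a => n + T a).
Proof.
move=> e_sym prA moveA disjA [sg0 step exitA disj].
(* At the seam [s = n] the second branch of [rewind] applies, and it agrees because [sg] starts at
   [loc a t]. *)
have rewindE a s : a \in A -> s <= n -> rewind loc t n sg a s = loc a (t + (n - s)).
  move=> Aa; rewrite /rewind leq_eqVlt => /predU1P[->|->] //.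
  by rewrite ltnn subnn addn0 sg0.
split=> [a Aa|a s Aa lt_s|a Aa|a b s Aa Ab neq_ab].
- by rewrite rewindE // subn0.
- have [lt_sn|le_ns] := ltnP s n.
    rewrite !rewindE // 1?ltnW //.
    have ->: t + (n - s) = (t + (n - s.+1)).+1 by lia.
    have := moveA a (t + (n - s.+1)) Aa.
    rewrite /stay_or_move /= eq_sym e_sym; apply; lia.
  rewrite /rewind !ltnNge le_ns (leqW le_ns) /= subSn //.
  by apply: step => //; lia.
- have [Xa notXa] := exitA a Aa; split.
    by rewrite /rewind ltnNge leq_addr /= addKn.
  move=> s lt_s; have [lt_sn|le_ns] := ltnP s n.
    by rewrite rewindE 1?ltnW // (present_notin_exits (prA a Aa)) //; lia.
  by rewrite /rewind ltnNge le_ns /= notXa //; lia.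
- rewrite /rewind; case: ltnP => [lt_sn _|le_ns le_s]; last by apply: disj => //; lia.
  have ->: t + (n - s) = (t + (n - s.+1)).+1 by lia.
  by apply: disjA => //; lia.
Qed.

Section Execution.

Variables (H : {set V}) (loc : V -> nat -> V).
Hypothesis loc_move : forall a s, a \in H -> present X loc s a ->
  stay_or_move e (loc a s) (loc a s.+1).

(** The invariant carried through colors and epochs. It is limited to agents still present, as the
    positions of an evacuated agent are meaningless. *)
Definition at_home t := forall a, a \in H -> present X loc t a -> loc a t = a.

Lemma single_phase_evacuates B t Z sg T a :
    symmetric e -> evacuation_strategy e X H id sg T ->
    strategy_length H T <= B -> at_home t -> single_phase e X H loc B t Z ->
    a \in H -> a \in Z ->
  evacuated_by X loc (t + phase_duration B) a.
Proof.
move=> e_sym optT le_TB home [ss_phase group_phase] Ha Za.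
apply: contraT => pr_a.
(* In a self-sufficient zone [a] would have left within [B] steps. *)
have not_ss: ~ self_sufficient e X B Z.
  move=> /ss_phase[sg1 [T1 [strat1 _ le_T1 run1]]].
  case/negP: (pr_a); apply: (@evacuated_by_leq _ (t + B)).
    by rewrite /phase_duration; lia.
  apply: executes_evacuates strat1 le_T1 run1 _; rewrite mem_crew Ha Za /=.
  by apply: present_leq pr_a; apply: leq_addr.
have [[disj _] [sg2 [T2 [strat2 le_T2 run2]]]] := group_phase not_ss.
(* The agent may already reach an exit during grouping; otherwise it takes part in the exclusive
   strategy. *)
case/negP: pr_a; case: (boolP (evacuated_by X loc (t + B) a)) => [|pr_a].
  by apply: evacuated_by_leq; rewrite /phase_duration; lia.
rewrite /phase_duration mulSn addnA.
apply: executes_evacuates strat2 (le_T2 _) run2 _; last by rewrite mem_crew Ha Za.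
pose A' := crew X H loc (t + B) Z.
have A'_H b : b \in A' -> b \in H /\ present X loc (t + B) b.
  by rewrite mem_crew => /and3P[].
have /subsetP A'_crew: A' \subset crew X H loc t Z by apply: crew_leq; apply: leq_addr.
(* [B] steps undo the grouping and at most [B] steps of [sg] follow, hence the bound [2 * B]. *)
exists (rewind loc t B sg), (fun b => B + T b); split; last first.
  apply/bigmax_leqP => b /A'_H[Hb _].
  have := leq_strategy_length T Hb; lia.
apply: rewind_strategy => // [b /A'_H[]//|b s /A'_H[Hb pr_b] lt_s|b c r A'b A'c neq_bc lt_rB|].
- by apply: loc_move => //; apply: present_leq pr_b; apply: ltnW.
- have [[_ pr_b] [_ pr_c]] := (A'_H b A'b, A'_H c A'c).
  apply: disj => //; try exact: A'_crew.
    by apply: present_leq pr_b; lia.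
  by apply: present_leq pr_c; lia.
(* [sg] starts from the homebases, which is where the remaining agents stood at time [t]. *)
- apply: evacuation_strategy_sub optT; first by apply/subsetP => b /A'_H[].
  move=> b /A'_H[Hb pr_b]; rewrite home //.
  by apply: present_leq pr_b; apply: leq_addr.
Qed.

Section Attempt.

Variables (B : nat) (P : {set {set V}}) (d : nat) (c : {set V} -> 'I_d).
Variable t : nat.
Hypotheses (partP : B_partition e X B P) (home : at_home t).
Hypothesis attempt : one_attempt e X H loc B P c t.

Lemma exists_zone a : exists2 Z, Z \in P & a \in Z.
Proof.
have [/and3P[/eqP coverP _ _] _] := partP.
have /bigcupP[Z PZ Za]: a \in cover P by rewrite coverP inE.
by exists Z.
Qed.

(** Induction on the number of colors processed: agents of the current color undo their phase, and
    all others stay idle. *)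
Lemma round_at_home i : i <= d -> at_home (t + i * round_duration B).
Proof.
elim: i => [|i IHi] lt_id a Ha; first by rewrite addn0; apply: home.
have {IHi} home_i := IHi (ltnW lt_id).
have [/= _ back idle] := attempt (Ordinal lt_id).
have [Z PZ Za] := exists_zone a.
set u := t + i * _ in home_i back idle.
have ->: t + i.+1 * round_duration B = u + round_duration B by rewrite /u; lia.
move=> pr_a; have pr_u: present X loc u a := present_leq (leq_addr _ _) pr_a.
have [cZ|cZ] := eqVneq (c Z) (Ordinal lt_id); last first.
  by rewrite (idle Z a _ PZ cZ) ?mem_crew ?Ha ?Za // home_i.
(* Backtracking for a full phase from the end of the phase leads back to the position at time
   [u]. *)
rewrite addnA (back Z PZ cZ a) ?addnK ?home_i // mem_crew Ha Za /=.
by apply: present_leq pr_a; rewrite leq_add2l leq_addr.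
Qed.

Lemma one_attempt_at_home : at_home (t + d * round_duration B).
Proof. exact: round_at_home. Qed.

(** The agent leaves in the phase for the color of its zone, at whose start everyone remaining is at
    home. *)
Lemma one_attempt_evacuates sg T a :
    symmetric e -> evacuation_strategy e X H id sg T ->
    strategy_length H T <= B -> a \in H ->
  evacuated_by X loc (t + d * round_duration B) a.
Proof.
move=> e_sym optT le_TB Ha; have [Z PZ Za] := exists_zone a.
have [/= phase _ _] := attempt (c Z).
have := single_phase_evacuates e_sym optT le_TB
  (round_at_home (ltnW (ltn_ord _))) (phase Z PZ erefl) Ha Za.
apply: evacuated_by_leq; rewrite -addnA leq_add2l.
have := leq_mul (ltn_ord (c Z)) (leqnn (round_duration B)).
by apply: leq_trans; rewrite mulSn addnC leq_add2r leq_addr.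
Qed.

End Attempt.

Lemma epoch_at_home d j :
  evacuation_execution e X H d loc -> at_home (elapsed d j).
Proof.
move=> [loc0 _ epoch]; elim: j => [|j IHj] a Ha /= pr_a; first exact: loc0.
have pr_j := present_leq (leq_addr _ _) pr_a.
(* An epoch takes place only if an agent is left; [a] itself is one. *)
have [|P [c [partP _ attempt]]] := epoch j; first by exists a.
exact: one_attempt_at_home partP IHj attempt a Ha pr_a.
Qed.

End Execution.

End Evacuation.

(** The factor 6 is a phase of [3 * B] steps plus as many for backtracking, per color. *)
Lemma elapsedE d p : elapsed d p = 6 * \sum_(1 <= j < p.+1) d j * 2 ^ j.
Proof.
elim: p => [|p IHp]; first by rewrite big_geq.
rewrite big_nat_recr //= mulnDr -IHp /round_duration /phase_duration; lia.
Qed.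

(** The maximum with 1 accounts for [opt <= 1]: the logarithm is then 0, but the first epoch already
    has [B = 2]. *)
Theorem theorem2 (V : finType) (e : rel V) (X H : {set V})
    (e_sym : symmetric e) (e_irr : irreflexive e)
    (X_neq0 : X != set0) (H_sub : H \subset ~: X)
    (opt : nat) (opt_min : is_OPT e X H opt)
    (d : nat -> nat) (loc : V -> nat -> V)
    (exec : evacuation_execution e X H d loc) :
  let p := maxn 1 (up_log 2 opt) in
  let s := 6 * \sum_(1 <= j < p.+1) d j * 2 ^ j in
  forall a, a \in H -> evacuated_by X loc s a.
Proof.
move=> p s a Ha; rewrite /s -elapsedE.
have [[sg [T [optT lenT]]] _] := opt_min.
have le_opt: opt <= 2 ^ p.
  by apply: leq_trans (up_logP opt (isT : 1 < 2)) _; rewrite leq_exp2l // leq_maxr.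
have p_gt0: 0 < p by apply: leq_maxl.
case: p p_gt0 le_opt {s} => // j _ le_opt.
(* Either [a] left before the epoch with [B = 2 ^ j.+1], or that epoch runs and [opt <= B] holds in
   it. *)
case: (boolP (evacuated_by X loc (elapsed d j) a)) => [|pr_a].
  exact/evacuated_by_leq/leq_addr.
have [_ loc_move epoch] := exec.
have [|P [c [partP _ attempt]]] := epoch j; first by exists a.
apply: (one_attempt_evacuates loc_move partP (epoch_at_home exec) attempt
  e_sym optT) => //.
by rewrite lenT.
Qed.
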